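(* The set of Hopfian groups $\{G \in \mathrm{TFAB}_\omega : \text{every surjective endomorphism of } G \text{ is injective}\}$ is a complete co-analytic subset of $\mathrm{TFAB}_\omega$.
   Context: $\mathrm{TFAB}_\omega$ is the Borel space of torsion-free abelian groups with domain $\omega = \mathbb{N}$: the set of all abelian torsion-free group structures with underlying set $\omega$, with the standard Borel structure inherited from the usual product space of structures with domain $\omega$ in the language of groups. A group $G$ is called Hopfian if every onto endomorphism of $G$ is one-to-one. A subset $A$ of a standard Borel space $Z$ is complete co-analytic in $Z$ if $A$ is co-analytic and for every standard Borel space $Y$ and every co-analytic $B \subseteq Y$ there is a Borel function $F : Y \to Z$ such that $B = F^{-1}(A)$. *)

(* Defs.v *)
From HB Require Import structures.
From mathcomp Require Import all_boot all_order all_algebra.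
From mathcomp Require Import all_classical all_reals all_analysis.

Set Implicit Arguments.
Unset Strict Implicit.
Unset Printing Implicit Defensive.

Import Order.TTheory GRing.Theory Num.Theory.

Local Open Scope classical_set_scope.

Definition complete_metric (R : realType) (M : metricType R) : Prop :=
  forall u : nat -> M, cauchy (u @ \oo) -> exists x : M, u @ \oo --> x.

Definition polish (R : realType) (X : topologicalType) : Prop :=
  (exists2 D : set X, countable D & dense D) /\
  exists (M : metricType R) (h : X -> M) (k : M -> X),
    [/\ cancel h k, cancel k h, continuous h, continuous k
      & complete_metric M].

Definition borel_of (X : ptopologicalType) := g_sigma_algebraType (@open X).

Definition borel_isomorphism (d d' : measure_display) (Y : measurableType d)
    (Z : measurableType d') (f : Y -> Z) : Prop :=
  exists g : Z -> Y, [/\ cancel f g, cancel g f,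
    measurable_fun setT f & measurable_fun setT g].

(* A [measurableType] is nonempty; the only standard Borel space left out is
   the empty one. *)
Definition standard_borel (R : realType) (d : measure_display)
    (Y : measurableType d) : Prop :=
  exists (X : ptopologicalType) (f : Y -> borel_of X),
    polish R X /\ borel_isomorphism f.

(* The domain [W] may be empty, so that the empty set is analytic. *)
Definition polish_analytic (R : realType) (X : topologicalType) (A : set X) :
    Prop :=
  exists (W : topologicalType) (f : W -> X),
    [/\ polish R W, continuous f & f @` setT = A].

(* In a standard Borel space, analyticity is transported from a Polish space
   along a Borel isomorphism; by a classical theorem it does not depend on the
   Polish space. If [analytic R A] holds for some [A : set Z], then [Z] is
   standard Borel. *)
Definition analytic (R : realType) (d : measure_display) (Z : measurableType d)
    (A : set Z) : Prop :=
  exists (X : ptopologicalType) (f : Z -> borel_of X),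
    [/\ polish R X, borel_isomorphism f & @polish_analytic R X (f @` A)].

Definition coanalytic (R : realType) (d : measure_display)
    (Z : measurableType d) (A : set Z) : Prop := analytic R (~` A).

Definition complete_coanalytic (R : realType) (d : measure_display)
    (Z : measurableType d) (A : set Z) : Prop :=
  coanalytic R A /\
  forall (d' : measure_display) (Y : measurableType d') (B : set Y),
    standard_borel R Y -> coanalytic R B ->
    exists F : Y -> Z, measurable_fun setT F /\ B = F @^-1` A.

(* Structures with domain [nat] in the language (+, -, 0) of groups, with the
   product topology of the discrete space [nat]. *)
Definition grp_struct : Type :=
  ({ptws (nat * nat)%type -> nat} * {ptws nat -> nat} * nat)%type.

HB.instance Definition _ := Topological.on grp_struct.
HB.instance Definition _ :=
  isPointed.Build grp_struct (fun=> 0%N, fun=> 0%N, 0%N).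

Definition gadd (G : grp_struct) (x y : nat) : nat := G.1.1 (x, y).
Definition gopp (G : grp_struct) (x : nat) : nat := G.1.2 x.
Definition gzero (G : grp_struct) : nat := G.2.
Definition gmuln (G : grp_struct) (n x : nat) : nat :=
  iter n (gadd G x) (gzero G).

Definition abelian_group (G : grp_struct) : Prop :=
  [/\ associative (gadd G), commutative (gadd G),
      left_id (gzero G) (gadd G)
    & left_inverse (gzero G) (gopp G) (gadd G)].

Definition torsion_free (G : grp_struct) : Prop :=
  forall n x, (0 < n)%N -> gmuln G n x = gzero G -> x = gzero G.

Definition tfab_set : set grp_struct :=
  [set G | abelian_group G /\ torsion_free G].

(* [measurableType] requires a distinguished point: we transport the group of
   integers along a bijection with [nat]. *)
Definition nat_of_int (z : int) : nat :=
  match z with Posz n => n.*2 | Negz n => n.*2.+1 end.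
Definition int_of_nat (n : nat) : int :=
  if odd n then Negz n./2 else Posz n./2.

Lemma nat_of_intK : cancel nat_of_int int_of_nat.
Proof.
by case=> n; rewrite /int_of_nat /= odd_double /= ?doubleK// uphalf_double.
Qed.

Lemma int_of_natK : cancel int_of_nat nat_of_int.
Proof.
move=> n; rewrite /int_of_nat; have := odd_double_half n.
by case: (odd n) => /= H; rewrite -[RHS]H.
Qed.

Definition int_struct : grp_struct :=
  ((fun p => nat_of_int (int_of_nat p.1 + int_of_nat p.2)%R),
   (fun x => nat_of_int (- int_of_nat x)%R), nat_of_int 0%R).

Lemma int_struct_tfab : int_struct \in tfab_set.
Proof.
apply/mem_set; split.
  split=> [x y z|x y|x|x]; rewrite /gadd /gopp /gzero /= ?nat_of_intK.
  - by rewrite addrA.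
  - by rewrite addrC.
  - by rewrite add0r int_of_natK.
  - by rewrite addNr.
move=> n x n0; have -> : gmuln int_struct n x = nat_of_int (int_of_nat x *+ n)%R.
  elim: n {n0} => [|n IH] //; rewrite /gmuln iterS -/(gmuln _ n x) IH.
  by rewrite /gadd /= !nat_of_intK mulrS.
move=> /(can_inj nat_of_intK) /eqP; rewrite mulrn_eq0 => /orP[/eqP n_eq0|/eqP xE].
  by rewrite n_eq0 in n0.
by rewrite -(int_of_natK x) xE.
Qed.

Definition TFAB : Type := set_type tfab_set.

HB.instance Definition _ := Choice.on TFAB.
HB.instance Definition _ :=
  isPointed.Build TFAB (exist _ int_struct int_struct_tfab).

Definition tfab_val (G : TFAB) : borel_of grp_struct := sval G.

(* The Borel sets of [TFAB] are the traces of those of the product space. *)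
Notation TFAB_omega := (g_sigma_algebra_preimageType tfab_val).

Definition endomorphism (G : grp_struct) (h : nat -> nat) : Prop :=
  forall x y, h (gadd G x y) = gadd G (h x) (h y).

Definition hopfian (G : grp_struct) : Prop :=
  forall h : nat -> nat, endomorphism G h ->
    (forall y, exists x, h x = y) -> injective h.

(* Main.v *)
Require Import Defs.
From mathcomp Require Import all_boot all_order all_algebra.
From mathcomp Require Import all_classical all_reals all_analysis.
Local Open Scope classical_set_scope.
From HB Require Import structures.
From mathcomp Require Import ring.

(** The set is co-analytic because a failure of the Hopf property of [G] is
    witnessed by a tuple [(G, h, s, a, b)], with [h] an endomorphism of [G],
    [s] a section of [h], and [a <> b] identified by [h]. All these conditions
    are closed, so that the witnesses form a Polish space, of which the
    non-Hopfian groups are a continuous image ([analytic_nonhopfian]).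

    For completeness, Suslin's representation attaches to each point [y] of a
    standard Borel space a tree [S y] of finite sequences of integers, in a
    Borel way, so that [y] lies in a given analytic set iff [S y] has an
    infinite branch ([suslin_treeP]). It remains to build from a tree a
    torsion-free abelian group that is Hopfian iff the tree has no infinite
    branch. Choose distinct primes [p_w] indexed by the finite sequences [w].
    The group attached to a tree [T] is the direct sum over [w] in [T] of the
    groups [R_w] of the rationals whose denominator is prime to [p_u] for every
    prefix [u] of [w], the empty one and [w] included.

    If [v] is not a prefix of [w], then [p_v] is invertible in [R_w], while only
    [0] is divisible by all the powers of [p_v] in [R_v]; hence there is no
    nonzero homomorphism from [R_w] to [R_v] ([endo_rigid]). An endomorphism
    [h] is thus a triangular matrix, which acts on [R_w] modulo the proper
    prefixes of [w] as the multiplication by some rational [a_w]. If [h] is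
    onto and [a_w = 0], a preimage of the generator of [R_w] has to involve
    proper extensions of [w] in [T], and [a_v = 0] for the longest of them
    ([surj_chain]). Repeating this yields an infinite branch. If there is none,
    then all the [a_w] are nonzero, and [h] vanishes on no nonzero element, as
    is seen at a node of maximal length in its support ([triangular_inj]).

    Conversely, a shift towards the root along an infinite branch is a
    homomorphism, since [R_w] is contained in [R_u] for [u] a prefix of [w]. It
    kills the root. It is not onto if each node of the branch has a single
    successor there, because these inclusions are strict. But partial fractions
    give [R_w = R_(wc) + R_(wc')] for two distinct successors of [w]
    ([semilocal_split]). So each entry of the sequences is split into two
    copies, [2i] and [2i+1] instead of [i], and both successors of a node over
    the branch are sent to it ([branch_shift_surj]).

    Lastly, the direct sums all live in the countable group [{poly rat}], where
    the coefficients are indexed by the finite sequences through a bijection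
    with [nat]. Counting the elements of a subgroup in the order of a fixed
    encoding of [{poly rat}] makes it a structure with domain [nat], in a Borel
    way. *)

Set Implicit Arguments.
Unset Strict Implicit.
Unset Printing Implicit Defensive.

Import Order.TTheory GRing.Theory Num.Theory.

(** * Rational numbers with restricted denominators *)
Section Localization.
Local Open Scope ring_scope.

Fixpoint nth_prime (n : nat) : nat :=
  if n is m.+1 then s2val (prime_above (nth_prime m)) else 2.

Lemma nth_prime_prime n : prime (nth_prime n).
Proof. by case: n => [//|n] /=; case: prime_above. Qed.

Lemma nth_prime_inj : injective nth_prime.
Proof.
have H : {homo nth_prime : m n / (m < n)%N}.
  by apply: homo_ltn => [? ? ?|n /=]; [exact: ltn_trans|case: prime_above].
by move=> m n mn; case: (ltngtP m n) => // /H; rewrite mn ltnn.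
Qed.

(** The localization of the integers at the prime [p]. *)
Definition plocal (p : nat) (q : rat) : Prop :=
  exists2 d : nat, ~~ (p %| d)%N & d%:R * q \is a Num.int.

Lemma plocal_int p q : prime p -> q \is a Num.int -> plocal p q.
Proof.
by move=> pp qZ; exists 1%N; rewrite ?mul1r// dvdn1 neq_ltn prime_gt1// orbT.
Qed.

Lemma plocalN p q : plocal p q -> plocal p (- q).
Proof. by move=> [d pd dq]; exists d => //; rewrite mulrN rpredN. Qed.

Lemma plocalM p a b : prime p -> plocal p a -> plocal p b -> plocal p (a * b).
Proof.
move=> pp [d pd da] [e pe eb]; exists (d * e)%N.
  by rewrite Euclid_dvdM// (negPf pd).
by rewrite natrM mulrACA rpredM.
Qed.

Lemma plocalD p a b : prime p -> plocal p a -> plocal p b -> plocal p (a + b).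
Proof.
move=> pp [d pd da] [e pe eb]; exists (d * e)%N.
  by rewrite Euclid_dvdM// (negPf pd).
rewrite natrM mulrDr rpredD//; last by rewrite -mulrA rpredM// rpred_nat.
by rewrite mulrAC rpredM ?rpred_nat.
Qed.

Lemma plocalV p n : ~~ (p %| n)%N -> plocal p n%:R^-1.
Proof.
move=> pn; exists n => //.
have n0 : n != 0%N by apply: contraNneq pn => ->; rewrite dvdn0.
by rewrite mulfV ?pnatr_eq0 ?rpred1.
Qed.

Lemma dvd_primeX p r k : prime p -> prime r -> r != p -> ~~ (p %| r ^ k)%N.
Proof.
move=> pp pr rp; rewrite Euclid_dvdX// negb_and; apply/orP; left.
by rewrite dvdn_prime2// eq_sym.
Qed.

(** An integer multiple [d * q] with [d] prime to [p] would have [p ^ k] as a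
    factor of its numerator for all [k]; [k] equal to the absolute value of the
    numerator of [q] is already too much. *)
Lemma plocal_divisible p q : prime p ->
  (forall k, plocal p (q / (p ^ k)%:R)) -> q = 0.
Proof.
move=> pp H; apply/eqP/contraT => q0.
have [d pd /intrP[m]] := H `|numq q|%N.
set k := `|numq q|%N => E.
have pk0 : (p ^ k)%:R != 0 :> rat by rewrite pnatr_eq0 -lt0n expn_gt0 prime_gt0.
have den0 : (denq q)%:~R != 0 :> rat by rewrite intr_eq0 denq_neq0.
have {}E : (d%:Z * numq q)%:~R = (m * (p ^ k)%:Z * denq q)%:~R :> rat.
  rewrite !rmorphM/= -!pmulrn -E numqE; field.
  by [].
move/intr_inj: E => /(congr1 absz); rewrite !abszM /= -/k => E.
have : (p ^ k %| d * k)%N by rewrite E mulnAC dvdn_mull.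
rewrite Gauss_dvdr; last by rewrite coprimeXl// prime_coprime.
move=> /dvdn_leq; rewrite lt0n absz_eq0 numq_eq0 q0 => /(_ isT).
by rewrite leqNgt ltn_expl// prime_gt1.
Qed.

(** Here [b] is the part of the partial fraction expansion of [q] that has a
    power of [p] as denominator; it comes from a Bezout relation between this
    power and the rest of the denominator of [q]. *)
Lemma principal_part p q : prime p ->
  exists2 b, plocal p (q - b) & forall r, prime r -> r != p -> plocal r b.
Proof.
move=> pp; have den_gt0 : (0 < `|denq q|)%N by rewrite absz_gt0 denq_neq0.
have [n pn] := pfactor_coprime pp den_gt0; set k := logn _ _ => En.
have cop : coprimez n%:Z (p ^ k)%:Z.
  by rewrite coprimezE /= coprime_sym coprimeXl.
have [[u v] /= E] := coprimezP _ _ cop.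
have n0 : n%:R != 0 :> rat.
  rewrite pnatr_eq0; apply: contraTneq pn => ->.
  by rewrite /coprime gcdn0 neq_ltn prime_gt1// orbT.
have pk0 : (p ^ k)%:R != 0 :> rat by rewrite pnatr_eq0 -lt0n expn_gt0 prime_gt0.
have Eq : q = (numq q)%:~R / (n%:R * (p ^ k)%:R).
  rewrite -natrM -En pmulrn absz_denq; exact/esym/divq_num_den.
have {}E : u%:~R * n%:R + v%:~R * (p ^ k)%:R = 1 :> rat.
  by rewrite !pmulrn -!rmorphM -rmorphD/= E.
exists ((numq q * u)%:~R / (p ^ k)%:R); last first.
  move=> r rp neq; apply: plocalM => //; first exact: plocal_int.
  by apply: plocalV; apply: dvd_primeX => //; rewrite eq_sym.
have -> : q - (numq q * u)%:~R / (p ^ k)%:R = (numq q * v)%:~R / n%:R.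
  rewrite {1}Eq !rmorphM/=.
  have -> : v%:~R = (1 - u%:~R * n%:R) / (p ^ k)%:R :> rat.
    by rewrite -[X in X - _]E addrAC subrr add0r mulfK.
  by field; rewrite n0.
apply: plocalM => //; first exact: plocal_int.
by apply: plocalV; rewrite -prime_coprime.
Qed.
End Localization.

(** * The direct sum attached to a tree *)
Section TreeGroup.
Local Open Scope ring_scope.
Implicit Types (u v w : seq nat) (q : rat) (f g : {poly rat}).

Definition node_prime w := nth_prime (CodeSeq.code w).

Lemma node_prime_prime w : prime (node_prime w).
Proof. exact: nth_prime_prime. Qed.
#[local] Hint Resolve node_prime_prime : core.

Lemma node_prime_inj : injective node_prime.
Proof. by move=> u v /nth_prime_inj/(can_inj CodeSeq.codeK). Qed.

Definition semilocal w q := forall u, prefix u w -> plocal (node_prime u) q.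

Lemma semilocal_int w q : q \is a Num.int -> semilocal w q.
Proof. by move=> qZ u _; exact: plocal_int. Qed.

Lemma semilocalD w a b : semilocal w a -> semilocal w b -> semilocal w (a + b).
Proof. by move=> wa wb u uw; apply: plocalD; auto. Qed.

Lemma semilocalN w a : semilocal w a -> semilocal w (- a).
Proof. by move=> wa u uw; apply/plocalN; auto. Qed.

Lemma semilocal_prefix u w q : prefix u w -> semilocal w q -> semilocal u q.
Proof. by move=> uw wq v vu; apply: wq; exact: prefix_trans vu uw. Qed.

(** The sum [R_w = R_(wc) + R_(wc')]: the two summands are [q] minus its
    principal part at the prime of [wc], and this principal part. *)
Lemma semilocal_split w c c' q : c != c' -> semilocal w q ->
  exists a b, [/\ q = a + b, semilocal (rcons w c) a & semilocal (rcons w c') b].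
Proof.
move=> cc' wq.
have [b qb b_p] := principal_part q (node_prime_prime (rcons w c)).
have {}b_p u : u != rcons w c -> plocal (node_prime u) b.
  move=> uwc; apply: b_p; first exact: node_prime_prime.
  by apply: contraNneq uwc => /node_prime_inj ->.
exists (q - b), b; split; first by rewrite subrK.
  move=> u; have [->//|uwc] := eqVneq u (rcons w c).
  move=> uw; apply: plocalD; [by []| |exact/plocalN/b_p].
  apply: wq; move: uw uwc; case/prefixP => t.
  case/lastP: t => [|t d]; first by rewrite cats0 => ->; rewrite eqxx.
  by rewrite -rcons_cat => /rcons_inj[-> _] _; exact: prefix_prefix.
move=> u uw; apply: b_p; apply: contraNneq cc' => uwc; move: uw.
rewrite uwc prefixE size_rcons -(size_rcons w c') take_size eqseq_rcons eqxx.
by rewrite eq_sym.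
Qed.

Lemma semilocal_divisible u w q k : ~~ prefix u w -> semilocal w q ->
  semilocal w (q / (node_prime u ^ k)%:R).
Proof.
move=> uw wq v vw; apply: plocalM; [by []|exact: wq|].
apply/plocalV/dvd_primeX => //.
by apply: contraNneq uw => /node_prime_inj ->.
Qed.

(** A polynomial encodes a finitely supported family of rationals indexed by
    finite sequences. *)
Definition coord f w : rat := f`_(CodeSeq.code w).

Definition monom w q : {poly rat} := q *: 'X^(CodeSeq.code w).

Lemma coordD f g w : coord (f + g) w = coord f w + coord g w.
Proof. exact: coefD. Qed.

Lemma coordN f w : coord (- f) w = - coord f w.
Proof. exact: coefN. Qed.

Lemma coord0 w : coord 0 w = 0.
Proof. exact: coef0. Qed.

Lemma coord_monom w q v : coord (monom w q) v = if v == w then q else 0.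
Proof.
rewrite /coord coefZ coefXn (inj_eq (can_inj CodeSeq.codeK)).
by case: eqP; rewrite ?mulr1 ?mulr0.
Qed.

Lemma coord_inj f g : coord f =1 coord g -> f = g.
Proof.
by move=> fg; apply/polyP => i; rewrite -(CodeSeq.decodeK i); exact: fg.
Qed.

Lemma monomD w a b : monom w (a + b) = monom w a + monom w b.
Proof. exact: scalerDl. Qed.

Lemma sum_monom f :
  f = \sum_(i < size f) monom (CodeSeq.decode i) (coord f (CodeSeq.decode i)).
Proof.
rewrite -[LHS]coefK poly_def; apply: eq_bigr => i _.
by rewrite /monom /coord CodeSeq.decodeK.
Qed.

Definition tree_group (T : set (seq nat)) : set {poly rat} :=
  [set f | forall w, coord f w != 0 -> T w /\ semilocal w (coord f w)].

Section Group.
Variable T : set (seq nat).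
Notation G := (tree_group T).

Lemma tree_group_semilocal f w : G f -> semilocal w (coord f w).
Proof.
move=> Gf; have [->|/Gf[]//] := eqVneq (coord f w) 0.
by apply: semilocal_int; rewrite rpred0.
Qed.

Lemma tree_groupD f g : G f -> G g -> G (f + g).
Proof.
move=> Gf Gg w; rewrite coordD => fg0; split.
  have [f0|/Gf[]//] := eqVneq (coord f w) 0.
  by move: fg0; rewrite f0 add0r => /Gg[].
by apply: semilocalD; exact: tree_group_semilocal.
Qed.

Lemma tree_groupN f : G f -> G (- f).
Proof.
move=> Gf w; rewrite coordN oppr_eq0 => /Gf[? ?]; split=> //.
exact: semilocalN.
Qed.

Lemma tree_group0 : G 0.
Proof. by move=> w; rewrite coord0 eqxx. Qed.

Lemma tree_group_monom w q : T w -> semilocal w q -> G (monom w q).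
Proof.
move=> Tw wq v; rewrite coord_monom.
by case: (v =P w) => [-> _|_]; [split|rewrite eqxx].
Qed.

Lemma tree_group_coord f w : G f -> G (monom w (coord f w)).
Proof.
move=> Gf v; rewrite coord_monom.
by case: (v =P w) => [->|_]; [exact: Gf|rewrite eqxx].
Qed.

Lemma tree_group_sum I (r : seq I) F :
  (forall i : I, G (F i)) -> G (\sum_(i <- r) F i).
Proof.
by move=> GF; apply: big_ind => //; [exact: tree_group0|exact: tree_groupD].
Qed.

Section Endo.
Variable h : {poly rat} -> {poly rat}.
Hypothesis hG : forall f, G f -> G (h f).
Hypothesis hD : forall f g, G f -> G g -> h (f + g) = h f + h g.

Lemma endo0 : h 0 = 0.
Proof.
have := hD tree_group0 tree_group0; rewrite addr0 => /eqP.
by rewrite -subr_eq0 opprD addrA subrr sub0r oppr_eq0 => /eqP.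
Qed.

Lemma endo_sum I (r : seq I) F :
  (forall i : I, G (F i)) -> h (\sum_(i <- r) F i) = \sum_(i <- r) h (F i).
Proof.
move=> GF; elim: r => [|i r IH]; first by rewrite !big_nil endo0.
by rewrite !big_cons hD ?IH//; exact: tree_group_sum.
Qed.

Lemma endo_muln w q n : T w -> semilocal w q ->
  h (monom w (n%:R * q)) = h (monom w q) *+ n.
Proof.
move=> Tw wq; elim: n => [|n IH]; first by rewrite mul0r /monom scale0r endo0.
have wnq : semilocal w (n%:R * q).
  elim: n {IH} => [|n IH].
    by rewrite mul0r; apply: semilocal_int; rewrite rpred0.
  by rewrite mulrSr mulrDl mul1r; exact: semilocalD.
by rewrite mulrSr mulrDl mul1r monomD hD ?IH ?mulrSr//; exact: tree_group_monom.
Qed.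

Lemma coordMn f n w : coord (f *+ n) w = n%:R * coord f w.
Proof. by rewrite /coord coefMn mulr_natl. Qed.

(** All the [q / p_v ^ k] belong to [R_w] when [v] is not a prefix of [w], so
    that the image of [q] in [R_v] is divisible by all the powers of [p_v]. *)
Lemma endo_rigid w v q : T w -> semilocal w q -> ~~ prefix v w ->
  coord (h (monom w q)) v = 0.
Proof.
move=> Tw wq vw; apply: (@plocal_divisible (node_prime v)).
  exact: node_prime_prime.
move=> k; have wqk := semilocal_divisible k vw wq.
have pk0 : (node_prime v ^ k)%:R != 0 :> rat.
  by rewrite pnatr_eq0 -lt0n expn_gt0 prime_gt0.
have -> : q = (node_prime v ^ k)%:R * (q / (node_prime v ^ k)%:R).
  by rewrite mulrC mulfVK.
rewrite endo_muln// coordMn mulrC mulKf//.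
apply: tree_group_semilocal (prefix_refl v).
by apply: hG; exact: tree_group_monom.
Qed.

(** A homomorphism from [R_w] to a torsion-free group is determined by its
    value at [1]: multiply by the denominator of [q]. *)
Lemma endo_diag w q : T w -> semilocal w q ->
  coord (h (monom w q)) w = q * coord (h (monom w 1)) w.
Proof.
move=> Tw wq; have w1 : semilocal w 1 by apply: semilocal_int; rewrite rpred1.
have H n a : semilocal w a ->
    coord (h (monom w (n%:R * a))) w = n%:R * coord (h (monom w a)) w.
  by move=> wa; rewrite endo_muln// coordMn.
have HN a : semilocal w a ->
    coord (h (monom w (- a))) w = - coord (h (monom w a)) w.
  move=> wa; apply/eqP; rewrite -addr_eq0 -coordD -hD; last 2 first.
  - by apply: tree_group_monom => //; exact: semilocalN.
  - exact: tree_group_monom.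
  by rewrite -monomD addNr /monom scale0r endo0 coord0.
have den0 : `|denq q|%:R != 0 :> rat by rewrite pnatr_eq0 absz_eq0 denq_neq0.
apply: (mulfI den0); rewrite -H// mulrA.
have -> : `|denq q|%:R * q = (numq q)%:~R.
  by rewrite pmulrn absz_denq mulrC numqE.
case: (numq q) => m; first by rewrite -pmulrn -[m%:R in LHS]mulr1 H.
by rewrite NegzE mulrNz HN -?pmulrn ?mulNr -1?[m.+1%:R in LHS]mulr1 ?H//;
  apply: semilocal_int; rewrite rpred_nat.
Qed.

Lemma coord_endo f v : G f -> coord (h f) v = \sum_(i < size f)
  coord (h (monom (CodeSeq.decode i) (coord f (CodeSeq.decode i)))) v.
Proof.
move=> Gf; rewrite {1}(sum_monom f) endo_sum; first by rewrite /coord coef_sum.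
by move=> i; exact: tree_group_coord.
Qed.

(** By rigidity only the extensions of [v] contribute to the coordinate at [v]
    of an image, and [v] is the only one of them in the support of [f]. *)
Lemma endo_top f v : G f -> coord f v != 0 ->
  (forall u, prefix v u -> (size v < size u)%N -> coord f u = 0) ->
  coord (h f) v = coord f v * coord (h (monom v 1)) v.
Proof.
move=> Gf fv0 vmax; have [Tv vf] := Gf _ fv0.
have vlt : (CodeSeq.code v < size f)%N.
  by rewrite ltnNge; apply: contra fv0 => le; rewrite /coord nth_default.
rewrite coord_endo// (bigD1 (Ordinal vlt))//= CodeSeq.codeK big1 ?addr0 => [|i iv].
  exact: endo_diag.
set u := CodeSeq.decode i; have uv : u != v.
  apply: contra iv => /eqP uv; apply/eqP/val_inj.
  by rewrite /= -uv CodeSeq.decodeK.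
have [fu0|fu0] := eqVneq (coord f u) 0.
  by rewrite fu0 /monom scale0r endo0 coord0.
have [Tu uf] := Gf _ fu0; apply: endo_rigid => //.
apply: contra fu0 => vu; apply/eqP/vmax => //.
by rewrite ltn_neqAle size_prefix ?andbT//; apply: contra uv => /eqP sz;
  rewrite eq_sym; move: vu; rewrite prefixE sz take_size eq_sym.
Qed.

Lemma exists_top (D : pred (seq nat)) f u : D u -> coord f u != 0 ->
  exists v, [/\ D v, coord f v != 0 &
    forall u, D u -> coord f u != 0 -> (size u <= size v)%N].
Proof.
have lt_size w : coord f w != 0 -> (CodeSeq.code w < size f)%N.
  by move=> fw0; rewrite ltnNge; apply: contra fw0 => le; rewrite /coord nth_default.
move=> Du fu0.
pose P (i : 'I_(size f)) :=
  D (CodeSeq.decode i) && (coord f (CodeSeq.decode i) != 0).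
have Pu : P (Ordinal (lt_size _ fu0)) by rewrite /P /= CodeSeq.codeK Du.
case: (arg_maxnP (fun i : 'I_(size f) => size (CodeSeq.decode i)) Pu).
move=> i /andP[Di fi] imax.
exists (CodeSeq.decode i); split=> // w Dw fw0.
have := imax (Ordinal (lt_size _ fw0)).
by rewrite /P /= CodeSeq.codeK; apply; rewrite Dw.
Qed.

(** Let [f] be a preimage of the generator at [w]. If the support of [f]
    contains proper extensions of [w], let [v] be one of maximal length: the
    coordinate of [h f] at [v] is [f_v * a_v], and it vanishes. Otherwise
    the coordinate of [h f] at [w] is [f_w * a_w = 0] instead of [1]. *)
Lemma surj_chain w : (forall g, G g -> exists2 f, G f & h f = g) ->
  T w -> coord (h (monom w 1)) w = 0 ->
  exists v,
    [/\ T v, coord (h (monom v 1)) v = 0, prefix w v & (size w < size v)%N].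
Proof.
move=> hsurj Tw aw0.
have [|f Gf hf] := hsurj (monom w 1).
  by apply: tree_group_monom => //; apply: semilocal_int; rewrite rpred1.
have hfw : coord (h f) w = 1 by rewrite hf coord_monom eqxx.
pose D u := prefix w u && (size w < size u)%N.
have [[u /andP[Du fu0]]|nD] := pselect (exists u, D u && (coord f u != 0)).
  have [v [/andP[wv szv] fv0 vmax]] := exists_top Du fu0.
  exists v; split=> //; first by have [] := Gf _ fv0.
  have : coord (h f) v = 0.
    by rewrite hf coord_monom; case: eqP szv => // ->; rewrite ltnn.
  rewrite endo_top// => [/eqP|t vt szt].
    by rewrite mulf_eq0 (negPf fv0) => /eqP.
  apply/eqP; apply: contraTT szt => ft0; rewrite -leqNgt; apply: vmax => //.
  by rewrite /D (prefix_trans wv vt) (leq_trans szv)// size_prefix.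
have fD u : prefix w u -> (size w < size u)%N -> coord f u = 0.
  move=> wu szu; apply/eqP; apply: contra_notT nD => fu0.
  by exists u; rewrite /D wu szu.
have := oner_neq0 rat; rewrite -hfw.
have [fw0|fw0] := eqVneq (coord f w) 0; last by rewrite endo_top// aw0 mulr0 eqxx.
suff -> : coord (h f) w = 0 by rewrite eqxx.
rewrite coord_endo// big1// => i _; set u := CodeSeq.decode i.
have [fu0|fu0] := eqVneq (coord f u) 0.
  by rewrite fu0 /monom scale0r endo0 coord0.
have [Tu uf] := Gf _ fu0; apply: endo_rigid => //.
apply: contra fu0 => wu; move: (wu); rewrite prefixE => /eqP wE.
have [szu|szu] := ltnP (size w) (size u); first by rewrite fD.
by rewrite -(take_oversize szu) wE fw0.
Qed.

Lemma triangular_inj : (forall w, T w -> coord (h (monom w 1)) w != 0) ->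
  forall f, G f -> h f = 0 -> f = 0.
Proof.
move=> a0 f Gf hf; apply: coord_inj => u; rewrite coord0.
apply/eqP/contraT => fu0.
have [v [_ fv0 vmax]] := @exists_top predT f u isT fu0.
have [Tv _] := Gf _ fv0.
have : coord (h f) v == 0 by rewrite hf coord0.
rewrite endo_top// => [|t vt szt].
  by rewrite mulf_eq0 (negPf fv0) (negPf (a0 _ Tv)).
by apply/eqP; apply: contraTT szt => ft0; rewrite -leqNgt; exact: vmax.
Qed.
End Endo.

Definition infinite_branch (S : set (seq nat)) :=
  exists b : nat -> nat, forall n, S (mkseq b n).

Hypothesis T_prefix : forall u w, prefix u w -> T w -> T u.

(** The terms of a strictly increasing chain have length at least their rank,
    hence the [k]-th entry of the branch can be read off the term of rank
    [k + 1]. *)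
Lemma chain_branch (P : set (seq nat)) w0 : P `<=` T -> P w0 ->
  (forall w, P w -> exists v, [/\ P v, prefix w v & (size w < size v)%N]) ->
  infinite_branch T.
Proof.
move=> PT Pw0 step.
have step' (x : {w | P w}) :
    {y : {w | P w} |
      prefix (sval x) (sval y) /\ (size (sval x) < size (sval y))%N}.
  case: x => w Pw; apply/cid; have [v [Pv wv sz]] := step _ Pw.
  by exists (exist _ v Pv).
have [s [_ sP]] := dependent_choice step' (exist _ w0 Pw0).
have s_size n : (n <= size (sval (s n)))%N.
  by elim: n => // n IH; have [_] := sP n; exact: leq_ltn_trans.
have s_pre m n : (m <= n)%N -> prefix (sval (s m)) (sval (s n)).
  elim: n => [|n IH]; first by rewrite leqn0 => /eqP ->; exact: prefix_refl.
  rewrite leq_eqVlt => /orP[/eqP->|/IH]; first exact: prefix_refl.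
  by move=> /prefix_trans; apply; case: (sP n).
exists (fun k => nth 0%N (sval (s k.+1)) k) => n.
suff -> : mkseq (fun k => nth 0%N (sval (s k.+1)) k) n = take n (sval (s n)).
  by apply: T_prefix (prefix_take _ _) _; apply: PT; exact: svalP (s n).
apply: (@eq_from_nth _ 0%N) => [|i]; first by rewrite size_mkseq size_takel.
rewrite size_mkseq => lt_in; rewrite nth_mkseq// nth_take//.
by have /prefixP[t ->] := s_pre _ _ lt_in; rewrite nth_cat s_size.
Qed.

Lemma wf_tree_group_hopfian h : ~ infinite_branch T ->
  (forall f, G f -> G (h f)) ->
  (forall f g, G f -> G g -> h (f + g) = h f + h g) ->
  (forall g, G g -> exists2 f, G f & h f = g) ->
  forall f, G f -> h f = 0 -> f = 0.
Proof.
move=> nT hG hD hS; apply: triangular_inj => // w Tw.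
apply/eqP => aw0; apply: nT.
pose P := [set v | T v /\ coord (h (monom v 1)) v = 0].
apply: (@chain_branch P w) => [v []//|//|].
move=> v [Tv av0]; have [u [Tu au0 vu szu]] := surj_chain hG hD hS Tv av0.
by exists u.
Qed.
End Group.
End TreeGroup.

(** * The shift along a branch *)
Section BranchShift.
Local Open Scope ring_scope.
Implicit Types (u v w : seq nat) (q : rat) (f g : {poly rat}).
Variables (S : set (seq nat)) (b : nat -> nat).
Hypothesis Sb : forall n, S (mkseq b n).
Let T : set (seq nat) := [set w | S (map half w)].
Notation G := (tree_group T).

(** The nodes [v] that are mapped on the branch [b] by halving their
    entries. *)
Definition on_branch v := map half v == mkseq b (size v).

Definition kid v (j : bool) := rcons v (j + (b (size v)).*2)%N.

(** The coordinates of the image of [f] under the map that sends the generators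
    at both successors [kid v j] of a node [v] over the branch to the generator
    at [v], kills the generator at the root, and fixes the other generators. *)
Definition shift_coord f v : rat :=
  if on_branch v then coord f (kid v false) + coord f (kid v true) else coord f v.

Definition branch_shift f : {poly rat} :=
  \poly_(i < size f) shift_coord f (CodeSeq.decode i).

(** Ensures that the images have degree at most that of [f], so that
    [branch_shift] truncates nothing. *)
Lemma leq_code_rcons v c : (CodeSeq.code v <= CodeSeq.code (rcons v c))%N.
Proof. by elim: v => //= x v IH; rewrite leq_pmul2l ?expn_gt0// ltnS leq_double. Qed.

Lemma coord_oversize f v : (size f <= CodeSeq.code v)%N -> coord f v = 0.
Proof. exact: nth_default. Qed.

Lemma coord_branch_shift f v : coord (branch_shift f) v = shift_coord f v.
Proof.
rewrite {1}/coord coef_poly CodeSeq.codeK; case: ltnP => // le.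
have le' c : (size f <= CodeSeq.code (rcons v c))%N.
  exact: leq_trans le (leq_code_rcons v c).
rewrite /shift_coord /kid (coord_oversize le) !(coord_oversize (le' _)).
by rewrite addr0 if_same.
Qed.

Lemma branch_shiftD f g : branch_shift (f + g) = branch_shift f + branch_shift g.
Proof.
apply: coord_inj => v; rewrite coordD !coord_branch_shift /shift_coord !coordD.
by case: ifP => // _; rewrite addrACA.
Qed.

Lemma on_branch_kid v j : on_branch v -> on_branch (kid v j).
Proof.
rewrite /on_branch /kid size_rcons map_rcons mkseqS => /eqP ->.
by rewrite half_bit_double.
Qed.

Lemma on_branchT v : on_branch v -> T v.
Proof. by rewrite /T /= => /eqP ->; exact: Sb. Qed.

Lemma branch_shift_group f : G f -> G (branch_shift f).
Proof.
move=> Gf v; rewrite coord_branch_shift /shift_coord.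
case: ifPn => [bv _|_]; last exact: Gf.
split; first exact: on_branchT.
by apply: semilocalD; apply: (semilocal_prefix (prefix_rcons v _));
  exact: tree_group_semilocal Gf.
Qed.

Lemma kid_inj u v i j : (kid u i == kid v j) = (u == v) && (i == j).
Proof.
rewrite eqseq_rcons; case: eqP => //= ->.
by rewrite eqn_add2r; case: i; case: j.
Qed.

Lemma branch_shift_kid v j q : on_branch v ->
  branch_shift (monom (kid v j) q) = monom v q.
Proof.
move=> bv; apply: coord_inj => u.
rewrite coord_branch_shift /shift_coord !coord_monom; case: ifPn => bu.
  rewrite !kid_inj; case: (u == v); last by rewrite /= addr0.
  by case: j; rewrite ?addr0 ?add0r.
case: eqP bu => [->|_ nu]; first by rewrite on_branch_kid.
by case: eqP nu => // ->; rewrite bv.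
Qed.

Lemma branch_shift_off v q :
  ~~ on_branch v -> branch_shift (monom v q) = monom v q.
Proof.
move=> nv; apply: coord_inj => u.
rewrite coord_branch_shift /shift_coord !coord_monom; case: ifPn => // bu.
have kv i : (kid u i == v) = false.
  by apply: contraNF nv => /eqP <-; exact: on_branch_kid.
by rewrite !kv addr0; case: eqP nv => // <-; rewrite bu.
Qed.

Lemma branch_shift_root q : branch_shift (monom [::] q) = 0.
Proof.
apply: coord_inj => u.
rewrite coord_branch_shift /shift_coord !coord_monom coord0.
case: ifPn => [bu|bu].
  have kn i : (kid u i == [::]) = false by rewrite /kid -size_eq0 size_rcons.
  by rewrite !kn addr0.
by case: eqP bu => // ->.
Qed.

(** It suffices to reach the multiples of the generators: those off the branch
    are fixed, and an element of [R_w], for [w] over the branch, is a sum of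
    elements of the [R_v] for the two successors [v] of [w]. *)
Lemma branch_shift_surj g : G g -> exists2 f, G f & branch_shift f = g.
Proof.
move=> Gg.
have pre w : exists2 f, G f & branch_shift f = monom w (coord g w).
  have Gw : G (monom w (coord g w)) := tree_group_coord Gg.
  have wq : semilocal w (coord g w) := tree_group_semilocal Gg.
  have [bw|nbw] := boolP (on_branch w); last first.
    by exists (monom w (coord g w)); last exact: branch_shift_off.
  have kk : (false + (b (size w)).*2 != true + (b (size w)).*2)%N.
    by rewrite eqn_add2r.
  have [x [y [qE wx wy]]] := semilocal_split kk wq.
  exists (monom (kid w false) x + monom (kid w true) y); last first.
    by rewrite branch_shiftD !branch_shift_kid// -monomD -qE.
  apply: tree_groupD; apply: tree_group_monom => //;
    exact/on_branchT/on_branch_kid.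
have /choice[F FP] : forall w,
    exists f, G f /\ branch_shift f = monom w (coord g w).
  by move=> w; have [f] := pre w; exists f.
exists (\sum_(i < size g) F (CodeSeq.decode i)).
  by apply: tree_group_sum => i; have [] := FP (CodeSeq.decode i).
rewrite (@endo_sum T _ (fun f g _ _ => branch_shiftD f g)).
  rewrite [RHS]sum_monom; apply: eq_bigr => i _.
  by have [] := FP (CodeSeq.decode i).
by move=> i; have [] := FP (CodeSeq.decode i).
Qed.

Lemma branch_shift_not_inj :
  [/\ G (monom [::] 1), branch_shift (monom [::] 1) = 0 & monom [::] 1 != 0].
Proof.
split; last by rewrite /monom scale1r monic_neq0 ?monicXn.
  apply: tree_group_monom; first exact: (Sb 0).
  by apply: semilocal_int; rewrite rpred1.
exact: branch_shift_root.
Qed.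
End BranchShift.

(** * Subgroups as structures on the natural numbers *)
Section Enumeration.
Variables (V : countType).
Implicit Types (H : set V) (f g : V).

Definition is_code H (i : nat) : bool := `[< exists2 g, H g & pickle g = i >].

(** The rank of [f] among the elements of [H] in the order of their codes. *)
Definition index_in H f : nat := count (is_code H) (iota 0 (pickle f)).

Lemma index_in_inj H f g : H f -> H g -> index_in H f = index_in H g -> f = g.
Proof.
have lt_index f' g' : H f' -> (pickle f' < pickle g')%N ->
    (index_in H f' < index_in H g')%N.
  move=> Hf lt; rewrite /index_in -(subnKC (ltnW lt)) iotaD count_cat add0n.
  rewrite -[X in (X < _)%N]addn0 ltn_add2l -has_count; apply/hasP.
  exists (pickle f'); last by apply/asboolP; exists f'.
  by rewrite mem_iota leqnn subnKC// ltnW.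
move=> Hf Hg fg; apply: (pcan_inj pickleK).
have [/(lt_index _ _ Hf)|/(lt_index _ _ Hg)|//] := ltngtP (pickle f) (pickle g).
  by rewrite fg ltnn.
by rewrite fg ltnn.
Qed.

(** The number of elements of [H] with code less than [N] increases by at most
    one with [N] and is unbounded, so it takes every value. *)
Lemma index_in_surj H (s : nat -> V) : injective s -> (forall i, H (s i)) ->
  forall n, exists2 f, H f & index_in H f = n.
Proof.
move=> s_inj Hs n.
have [N HN] : exists N, (n < count (is_code H) (iota 0 N))%N.
  have [N ltN] : exists N, forall j, (j < n.+1)%N -> (pickle (s j) < N)%N.
    exists (\max_(j < n.+1) pickle (s j)).+1 => j ltj.
    exact: (@leq_bigmax _ (fun j : 'I_n.+1 => pickle (s j)) (Ordinal ltj)).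
  exists N; rewrite -size_filter -(size_iota 0 n.+1) -(size_map (pickle \o s)).
  apply: uniq_leq_size.
    by rewrite map_inj_uniq ?iota_uniq// => i j /(pcan_inj pickleK)/s_inj.
  move=> _ /mapP[j + ->]; rewrite mem_iota add0n => /andP[_ ltj].
  rewrite mem_filter mem_iota; apply/andP; split; last exact: ltN.
  by apply/asboolP; exists (s j).
elim: N HN => // N IH.
rewrite -[N.+1]addn1 iotaD count_cat add0n /= addn0 => HN.
have [/IH//|le] := ltnP n (count (is_code H) (iota 0 N)).
move: HN; rewrite {2}/is_code; case: asboolP => [[f Hf fN]|_]; last first.
  by rewrite addn0 ltnNge le.
rewrite addn1 ltnS => ge; exists f => //.
by apply/eqP; rewrite /index_in fN eqn_leq le.
Qed.

Definition nth_in (v0 : V) H (n : nat) : V :=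
  xget v0 [set f | H f /\ index_in H f = n].

Lemma nth_in_index v0 H f : H f -> nth_in v0 H (index_in H f) = f.
Proof.
move=> Hf; apply: xget_unique => [//|g [Hg]]; exact: index_in_inj.
Qed.

Section Infinite.
Variables (v0 : V) (H : set V) (s : nat -> V).
Hypotheses (s_inj : injective s) (Hs : forall i, H (s i)).

Lemma nth_inP n : H (nth_in v0 H n) /\ index_in H (nth_in v0 H n) = n.
Proof.
have [f Hf fn] := index_in_surj s_inj Hs n.
by apply: (@xgetPex _ v0 [set f | H f /\ index_in H f = n]); exists f.
Qed.

Lemma nth_in_mem n : H (nth_in v0 H n). Proof. by have [] := nth_inP n. Qed.

Lemma nth_inK n : index_in H (nth_in v0 H n) = n.
Proof. by have [] := nth_inP n. Qed.
End Infinite.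
End Enumeration.

Section GroupOfSubgroup.
Local Open Scope ring_scope.
Implicit Types (H : set {poly rat}) (f g : {poly rat}).

(** The structure carried to [nat] along the bijection [index_in H]. *)
Definition subgroup_struct H : grp_struct :=
  let nth_H := nth_in 0 H in let ix := index_in H in
  (fun p => ix (nth_H p.1 + nth_H p.2), fun x => ix (- nth_H x), ix 0).

Variables (H : set {poly rat}) (s : nat -> {poly rat}).
Hypotheses (s_inj : injective s) (Hs : forall i, H (s i)).
Hypotheses (H0 : H 0) (HN : forall f, H f -> H (- f)).
Hypothesis HD : forall f g, H f -> H g -> H (f + g).

Let N := nth_in 0 H.
Let I := index_in H.
Let HNn n : H (N n) := nth_in_mem 0 s_inj Hs n.
Let NK n : I (N n) = n := nth_inK 0 s_inj Hs n.
Let IK f : H f -> N (I f) = f := @nth_in_index _ 0 H f.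
Let G := subgroup_struct H.

Lemma gadd_subgroup x y : gadd G x y = I (N x + N y). Proof. by []. Qed.

Lemma gmuln_subgroup n x : N (gmuln G n x) = N x *+ n /\ H (N x *+ n).
Proof.
elim: n => [|n [IH Hn]]; first by rewrite mulr0n; split => //; exact: IK.
rewrite /gmuln iterS -/(gmuln G n x) gadd_subgroup IH mulrS.
by split; [apply: IK|]; exact: HD.
Qed.

Lemma subgroup_struct_tfab : tfab_set G.
Proof.
split.
  split=> [x y z|x y|x|x].
  - by rewrite !gadd_subgroup !IK ?addrA//; exact: HD.
  - by rewrite !gadd_subgroup addrC.
  - by rewrite gadd_subgroup [N (gzero G)]IK// add0r NK.
  - by rewrite gadd_subgroup [N (gopp G x)]IK ?addNr//; exact: HN.
move=> n x n0 /(congr1 N); have [-> _] := gmuln_subgroup n x.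
rewrite [N (gzero G)]IK// => /eqP.
rewrite -scaler_nat scaler_eq0 pnatr_eq0 eqn0Ngt n0 /= => /eqP nx0.
by rewrite -(NK x) nx0.
Qed.

Lemma hopfian_subgroup :
  (forall h : {poly rat} -> {poly rat}, (forall f, H f -> H (h f)) ->
    (forall f g, H f -> H g -> h (f + g) = h f + h g) ->
    (forall g, H g -> exists2 f, H f & h f = g) ->
    forall f, H f -> h f = 0 -> f = 0) ->
  hopfian G.
Proof.
move=> hopf k kD kS x y kxy.
pose h f := N (k (I f)).
have hD f g : H f -> H g -> h (f + g) = h f + h g.
  move=> Hf Hg; rewrite /h -[f in LHS]IK// -[g in LHS]IK//.
  rewrite -gadd_subgroup kD gadd_subgroup IK//.
  exact: HD.
have := hopf h _ hD _ (N x - N y).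
have Hxy : H (N x - N y) by apply: HD => //; exact: HN.
move=> xy0; rewrite -[x]NK -[y]NK; congr I; apply/eqP; rewrite -subr_eq0.
apply/eqP; apply: xy0 => [f _|g Hg|//|]; first exact: HNn.
  have [z kz] := kS (I g); exists (N z) => //.
  by rewrite /h NK kz IK.
apply: (@addIr _ (h (N y))); rewrite -hD// subrK add0r.
by rewrite /h !NK kxy.
Qed.

Lemma nonhopfian_subgroup (h : {poly rat} -> {poly rat}) f :
  (forall f, H f -> H (h f)) ->
  (forall f g, H f -> H g -> h (f + g) = h f + h g) ->
  (forall g, H g -> exists2 f, H f & h f = g) ->
  H f -> h f = 0 -> f != 0 -> ~ hopfian G.
Proof.
move=> hH hD hS Hf hf0 f0 /(_ (fun n => I (h (N n)))) hopf.
have h00 : h 0 = 0.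
  by apply: (@addIr _ (h 0)); rewrite -hD// !add0r.
have inj : injective (fun n => I (h (N n))).
  apply: hopf => [x y|y].
    by rewrite !gadd_subgroup !IK ?hD//; [exact: hH|exact: hH|exact: HD].
  by have [g Hg gy] := hS _ (HNn y); exists (I g); rewrite IK// gy NK.
move/eqP: f0; apply; rewrite -[f]IK// -[0]IK//; congr N; apply: inj => /=.
by rewrite !IK// hf0 h00.
Qed.
End GroupOfSubgroup.

(** * Borel dependence on the subgroup *)
Section MeasurableStructure.
Context d (Y : measurableType d).

Lemma measurable_exists (I : countType) (P : I -> set Y) :
  (forall i, measurable [set y | P i y]) -> measurable [set y | exists i, P i y].
Proof.
move=> mP; rewrite (_ : [set y | _] = \bigcup_i P i).
  exact: countable_bigcupT_measurable.
by apply/seteqP; split => y [i]; [exists i|move=> _; exists i].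
Qed.

Lemma measurable_forall (I : countType) (P : I -> set Y) :
  (forall i, measurable [set y | P i y]) -> measurable [set y | forall i, P i y].
Proof.
move=> mP; rewrite (_ : [set y | _] = ~` [set y | exists i, (~` P i) y]).
  by apply/measurableC/measurable_exists => i; apply: measurableC; exact: mP.
apply/seteqP; split => y /=; first by move=> Py [i] /(_ (Py i)).
by move=> nP i; apply: contrapT => nPi; apply: nP; exists i.
Qed.

Lemma measurable_and (P Q : set Y) : measurable P -> measurable Q ->
  measurable [set y | P y /\ Q y].
Proof. exact: measurableI. Qed.

Lemma measurable_cst_prop (P : Prop) : measurable [set _ : Y | P].
Proof.
have [p|np] := pselect P.
  by rewrite (_ : [set _ | P] = setT)//; apply/seteqP; split.
by rewrite (_ : [set _ | P] = set0)//; apply/seteqP; split.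
Qed.

Lemma measurable_imply (P : Prop) (Q : set Y) : (P -> measurable Q) ->
  measurable [set y | P -> Q y].
Proof.
move=> mQ; have [p|np] := pselect P.
  by rewrite (_ : [set y | _] = Q); [exact: mQ|apply/seteqP; split=> y //=; exact].
by rewrite (_ : [set y | _] = setT)//; apply/seteqP; split => y //= _ /np.
Qed.

Section Enum.
Variables (V : countType) (H : Y -> set V).
Hypothesis mH : forall f, measurable [set y | H y f].

(** A count over finitely many codes is a Boolean combination of the conditions
    that elements of [V] belong to [H y]. *)
Lemma measurable_count (s : seq nat) n :
  measurable [set y | count (is_code (H y)) s = n].
Proof.
have mcode i : measurable [set y | is_code (H y) i].
  rewrite (_ : [set y | _] = [set y | exists g, H y g /\ pickle g = i]).
    apply: measurable_exists => g; apply: measurable_and; first exact: mH.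
    exact: measurable_cst_prop.
  apply/seteqP; split=> y /=; first by move=> /asboolP[g]; exists g.
  by case=> g [? ?]; apply/asboolP; exists g.
elim: s n => [|i s IH] n /=; first exact: measurable_cst_prop.
rewrite (_ : [set y | _] =
    ([set y | is_code (H y) i] `&` [set y | (count (is_code (H y)) s).+1 = n])
    `|` (~` [set y | is_code (H y) i] `&`
         [set y | count (is_code (H y)) s = n])).
  apply: measurableU; apply: measurableI => //; last exact: measurableC.
  case: n => [|n].
    by rewrite (_ : [set y | _] = set0)//; apply/seteqP; split.
  rewrite (_ : [set y | _] = [set y | count (is_code (H y)) s = n])//.
  by apply/seteqP; split=> y /= => [[]|->].
apply/seteqP; split=> y /=.
  by case: is_code => <-; [left|right].
by case=> -[]; [move=> -> <-|move/negP/negPf => -> <-].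
Qed.

Lemma measurable_index_in f n : measurable [set y | index_in (H y) f = n].
Proof. exact: measurable_count. Qed.

Lemma measurable_nth_in (v0 : V) (s : Y -> nat -> V) :
  (forall y, injective (s y)) ->
  (forall y i, H y (s y i)) ->
  forall n f, measurable [set y | nth_in v0 (H y) n = f].
Proof.
move=> s_inj Hs n f.
rewrite (_ : [set y | _] = [set y | H y f /\ index_in (H y) f = n]).
  by apply: measurable_and; [exact: mH|exact: measurable_index_in].
apply/seteqP; split=> y /=; first by move=> <-; exact: nth_inP (s_inj y) (Hs y) n.
by case=> Hf <-; exact: nth_in_index.
Qed.
End Enum.

Lemma measurable_subgroup_struct (H : Y -> set {poly rat})
    (s : Y -> nat -> {poly rat}) :
  (forall f, measurable [set y | H y f]) ->
  (forall y, injective (s y)) -> (forall y i, H y (s y i)) ->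
  [/\ forall p n, measurable [set y | (subgroup_struct (H y)).1.1 p = n],
      forall x n, measurable [set y | (subgroup_struct (H y)).1.2 x = n] &
      forall n, measurable [set y | (subgroup_struct (H y)).2 = n]].
Proof.
move=> mH s_inj Hs; have mnth := measurable_nth_in mH 0%R s_inj Hs.
split=> [[a b] n|x n|n] /=; last exact: measurable_index_in.
  rewrite (_ : [set y | _] = [set y | exists f, exists g,
      (nth_in 0%R (H y) a = f /\ nth_in 0%R (H y) b = g) /\
      index_in (H y) (f + g)%R = n]).
    apply: measurable_exists => f; apply: measurable_exists => g.
    apply: measurable_and; last exact: measurable_index_in.
    by apply: measurable_and; exact: mnth.
  apply/seteqP; split=> y /=; last by move=> [f [g [[<- <-]]]].
  by move=> <-; do 2 eexists; split; first split.
rewrite (_ : [set y | _] = [set y | exists f,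
    nth_in 0%R (H y) x = f /\ index_in (H y) (- f)%R = n]).
  apply: measurable_exists => f.
  by apply: measurable_and; [exact: mnth|exact: measurable_index_in].
apply/seteqP; split=> y /=; last by move=> [f [<-]].
by move=> <-; eexists; split.
Qed.

Lemma measurable_tree_group (T : Y -> set (seq nat)) :
  (forall w, measurable [set y | T y w]) ->
  forall f, measurable [set y | tree_group (T y) f].
Proof.
move=> mT f; apply: measurable_forall => w; apply: measurable_imply => _.
by apply: measurable_and; [exact: mT|exact: measurable_cst_prop].
Qed.
End MeasurableStructure.

(** * Closed subsets of the Baire space *)
Section FirstDifference.
Variable R : realType.
Local Open Scope ring_scope.
Implicit Types (s t u : nat -> nat).

Lemma half_expn_gt0 n : 0 < 2^-1 ^+ n :> R.
Proof. by rewrite exprn_gt0 ?invr_gt0. Qed.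

Lemma half_expn_small (e : R) : 0 < e -> exists n, 2^-1 ^+ n < e.
Proof.
move=> e0; exists (Num.bound e^-1).
rewrite exprVn -[ltRHS]invrK ltf_pV2 ?posrE ?invr_gt0// ?exprn_gt0//.
apply: lt_trans (archi_boundP _) _; first by rewrite invr_ge0 ltW.
by rewrite -natrX ltr_nat ltn_expl.
Qed.

Definition agree (n : nat) s t := forall i, (i < n)%N -> s i = t i.

Lemma agreeW m n s t : (m <= n)%N -> agree n s t -> agree m s t.
Proof. by move=> mn st i im; apply: st; exact: leq_trans mn. Qed.

(** The ultrametric [2 ^ - n], where [n] is the first index at which the
    sequences differ. *)
Definition baire_dist s t : R :=
  if pselect (exists n, s n != t n) is left e then 2^-1 ^+ ex_minn e else 0.

Lemma baire_dist_le s t n : baire_dist s t <= 2^-1 ^+ n <-> agree n s t.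
Proof.
rewrite /baire_dist; case: pselect => [e|ne]; last first.
  split=> [_ i _|_]; last by rewrite exprn_ge0.
  by apply/eqP/contraT => ni; case: ne; exists i.
case: ex_minnP => m sm mmin; rewrite ler_iXn2l ?invr_gt0// ?invf_lt1 ?ltr1n//.
split=> [nm i lt|st].
  apply/eqP/contraT => /mmin; rewrite leqNgt => /negP[].
  exact: leq_trans nm.
by rewrite leqNgt; apply: contraNN sm => /st ->.
Qed.

Lemma baire_distE s t :
  (s = t /\ baire_dist s t = 0) \/
  exists n, [/\ agree n s t, s n <> t n & baire_dist s t = 2^-1 ^+ n].
Proof.
have [e|ne] := pselect (exists n, s n != t n).
  right; exists (ex_minn e); split; last first.
  - by rewrite /baire_dist; case: pselect => // e'; rewrite (Prop_irrelevance e e').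
  - by case: ex_minnP => m /eqP.
  - case: ex_minnP => m _ mmin i; rewrite ltnNge => im; apply/eqP/contraT => /mmin.
    by rewrite (negPf im).
left; split; last by rewrite /baire_dist; case: pselect.
by apply/funext => i; apply/eqP/contraT => ni; case: ne; exists i.
Qed.

Lemma baire_dist_ge s t n : s n <> t n -> 2^-1 ^+ n <= baire_dist s t.
Proof.
move=> st; case: (baire_distE s t) => [[st' _]|[m [ag _ ->]]].
  by rewrite st' in st.
rewrite ler_iXn2l ?invr_gt0// ?invf_lt1 ?ltr1n//.
by rewrite leqNgt; apply/negP => /ag.
Qed.

Lemma baire_distxx s : baire_dist s s = 0.
Proof. by case: (baire_distE s s) => [[]|[n []]]. Qed.

Lemma baire_dist_eq0 s t : baire_dist s t = 0 -> s = t.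
Proof.
case: (baire_distE s t) => [[]//|[n [_ _ ->]] /eqP].
by rewrite expf_eq0 invr_eq0 pnatr_eq0 andbF.
Qed.

Lemma baire_dist_ge0 s t : 0 <= baire_dist s t.
Proof. by case: (baire_distE s t) => [[_ ->]|[n [_ _ ->]]]//; rewrite exprn_ge0. Qed.

Lemma baire_dist_sym s t : baire_dist s t = baire_dist t s.
Proof.
have le x y : baire_dist x y <= baire_dist y x.
  case: (baire_distE x y) => [[_ ->]|[n [_ nxy ->]]].
    exact: baire_dist_ge0.
  by apply: baire_dist_ge => /esym.
by apply/eqP; rewrite eq_le !le.
Qed.

Lemma baire_dist_triangle t s u : baire_dist s u <= baire_dist s t + baire_dist t u.
Proof.
case: (baire_distE s u) => [[_ ->]|[n [_ su ->]]].
  by rewrite addr_ge0// baire_dist_ge0.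
have [st|st] := eqVneq (s n) (t n).
  rewrite -[leLHS]add0r lerD ?baire_dist_ge0// baire_dist_ge//.
  by rewrite -st.
by rewrite -[leLHS]addr0 lerD ?baire_dist_ge0// baire_dist_ge//; exact/eqP.
Qed.
End FirstDifference.

Section BaireSpace.
Variable R : realType.

(** The map [c] identifies [Z] with a closed subset of the Baire space. *)
Definition closed_code (Z : Type) (c : Z -> nat -> nat) :=
  injective c /\
  forall l, (forall n, exists z, agree n (c z) l) -> exists z, c z = l.

Section Space.
Variables (Z : choiceType) (c : Z -> nat -> nat) (cc : closed_code c).

(** A copy of [Z] with the topology and the metric inherited from the Baire
    space; [r] and [cc] are recorded in the type for the metric structure to be
    found from it. *)
Definition baire_sub (r : realType) (cc : closed_code c) : Type := Z.
Local Notation M := (baire_sub R cc).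

HB.instance Definition _ := Choice.on M.

Let dist (x y : M) : R := baire_dist R (c x) (c y).
Let distxx x : dist x x = 0%R. Proof. exact: baire_distxx. Qed.
Let dist_eq0 x y : dist x y = 0%R -> x = y.
Proof. by move/baire_dist_eq0/(proj1 cc). Qed.
Let dist_sym x y : dist x y = dist y x. Proof. exact: baire_dist_sym. Qed.
Let dist_triangle y x z : (dist x z <= dist x y + dist y z)%R.
Proof. exact: baire_dist_triangle. Qed.

HB.instance Definition _ :=
  isMetric.Build R M distxx dist_eq0 dist_sym dist_triangle.

Lemma ball_agree (x y : M) n : ball x (2^-1 ^+ n)%R y -> agree n (c x) (c y).
Proof. by rewrite ballEmdist => /= /ltW /baire_dist_le. Qed.

Lemma agree_ball (x y : M) n : agree n.+1 (c x) (c y) -> ball x (2^-1 ^+ n)%R y.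
Proof.
move=> /(baire_dist_le R) xy; rewrite ballEmdist /=; apply: le_lt_trans xy _.
by rewrite ltr_iXn2l ?invr_gt0// invf_lt1 ?ltr1n.
Qed.

Lemma baire_sub_nbhs (x : M) (A : set M) :
  nbhs x A <-> exists n, forall y : M, agree n (c x) (c y) -> A y.
Proof.
split=> [/nbhs_ballP[e /= /half_expn_small[n ne] xA]|[n xA]].
  exists n.+1 => y /agree_ball xy; apply: xA; exact: le_ball (ltW ne) _ xy.
apply/nbhs_ballP; exists (2^-1 ^+ n)%R => /=; first exact: half_expn_gt0.
by move=> y /ball_agree; exact: xA.
Qed.

(** Along a Cauchy sequence each coordinate of the codes is eventually
    constant, and closedness provides a point that has the limit as code. *)
Lemma baire_sub_complete : complete_metric M.
Proof.
move=> u /(cauchy_ballP _) u_cauchy.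
have /choice[N NP] : forall n, exists N, forall p q, (N <= p)%N -> (N <= q)%N ->
    agree n (c (u p)) (c (u q)).
  move=> n.
  have [[A B] [/= [a _ aA] [b _ bB]] AB] := u_cauchy _ (half_expn_gt0 R n).
  exists (maxn a b) => p q; rewrite !geq_max => /andP[ap _] /andP[_ bq].
  by apply: ball_agree; apply: (AB (u p, u q)); split; [exact: aA|exact: bB].
have lim p n i : (i < n)%N -> (N n <= p)%N -> c (u p) i = c (u (N i.+1)) i.
  move=> lt_in Np; set q := maxn (N n) (N i.+1).
  rewrite (NP n p q)// ?leq_maxl//; apply: (NP i.+1) => //.
  exact: leq_maxr.
have [n|z zl] := cc.2 (fun i => c (u (N i.+1)) i).
  by exists (u (N n)) => i lt_in; exact: lim lt_in _.
exists z => A /baire_sub_nbhs[n zA]; exists (N n) => // p /= Np.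
by apply: zA => i lt_in; rewrite zl (lim p n i).
Qed.

(** One point is chosen, when there is one, for each finite initial segment of
    a code. *)
Lemma baire_sub_separable : exists2 D : set M, countable D & dense D.
Proof.
have [[z0 _]|nZ] := pselect (exists z : M, True); last first.
  by exists set0 => // O [z]; case: nZ; exists z.
pose pt (s : seq nat) : M :=
  xget z0 [set z | forall i, (i < size s)%N -> c z i = nth 0%N s i].
exists (range pt).
  by apply: (card_le_trans (card_image_le _ _)); exact: countableP.
move=> O [z Oz] oO; have /baire_sub_nbhs[n zO] := open_nbhs_nbhs (conj oO Oz).
exists (pt (mkseq (c z) n)); split; last by exists (mkseq (c z) n).
have ptP : forall i, (i < size (mkseq (c z) n))%N ->
    c (pt (mkseq (c z) n)) i = nth 0%N (mkseq (c z) n) i.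
  apply: (@xgetPex _ z0 [set y | forall i, _ -> c y i = nth 0%N (mkseq (c z) n) i]).
  by exists z => i /=; rewrite size_mkseq => lt_in; rewrite nth_mkseq.
by apply: zO => i lt_in; rewrite ptP ?size_mkseq// nth_mkseq.
Qed.

Lemma baire_sub_polish : polish R M.
Proof.
split; first exact: baire_sub_separable.
exists M, id, id; split => //; last exact: baire_sub_complete.
- by move=> x; exact: cvg_id.
- by move=> x; exact: cvg_id.
Qed.
End Space.
End BaireSpace.

(** * Codes of products and of closed subsets *)
Section Codes.

(** [P] is closed for the topology given by the code [c]. *)
Definition stable_under (Z : Type) (c : Z -> nat -> nat) (P : set Z) :=
  forall z, (forall n, exists2 z', P z' & agree n (c z') (c z)) -> P z.

Lemma closed_code_nat : closed_code (fun (n _ : nat) => n).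
Proof.
split=> [m n /(congr1 (@^~ 0%N))//|l lP]; have [k k0] := lP 1%N; exists k.
apply/funext => i; have [k' k'P] := lP i.+1.
by rewrite (k0 0%N)// -(k'P 0%N)// (k'P i).
Qed.

(** The value [i0] fills in the indices that are the code of no element of
    [I]. *)
Definition fun_code (I : countType) (i0 : I) (F : I -> nat) (n : nat) :=
  F (odflt i0 (unpickle n)).

Lemma fun_codeE (I : countType) (i0 : I) F i : fun_code i0 F (pickle i) = F i.
Proof. by rewrite /fun_code pickleK. Qed.

Lemma closed_code_fun (I : countType) (i0 : I) : closed_code (fun_code i0).
Proof.
split=> [F F' FF'|l lP].
  by apply/funext => i; rewrite -(fun_codeE i0 F) FF' fun_codeE.
exists (l \o pickle); apply/funext => n; rewrite /fun_code /=; set i := odflt _ _.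
have [F FP] := lP (maxn n (pickle i)).+1.
rewrite -(FP n) ?ltnS ?leq_maxl// -(FP (pickle i)) ?ltnS ?leq_maxr//.
by rewrite fun_codeE.
Qed.

Definition pair_code (Z1 Z2 : Type) (c1 : Z1 -> nat -> nat)
    (c2 : Z2 -> nat -> nat) (z : Z1 * Z2) (i : nat) :=
  if odd i then c2 z.2 i./2 else c1 z.1 i./2.

Section Pair.
Context (Z1 Z2 : Type) (c1 : Z1 -> nat -> nat) (c2 : Z2 -> nat -> nat).
Local Notation c := (pair_code c1 c2).

Lemma pair_code1 z i : c z i.*2 = c1 z.1 i.
Proof. by rewrite /pair_code odd_double doubleK. Qed.

Lemma pair_code2 z i : c z i.*2.+1 = c2 z.2 i.
Proof. by rewrite /pair_code /= odd_double /= uphalf_double. Qed.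

Lemma agree_pair n z z' : agree n.*2 (c z) (c z') <->
  agree n (c1 z.1) (c1 z'.1) /\ agree n (c2 z.2) (c2 z'.2).
Proof.
split=> [zz'|[z1 z2] i].
  split=> i lt; first by rewrite -!pair_code1 zz'// ltn_double.
  by rewrite -!pair_code2 zz'// ltn_Sdouble.
rewrite -[i]odd_double_half; case: (odd i) => lt.
  by rewrite add1n !pair_code2 z2//; move: lt; rewrite ltn_Sdouble.
by rewrite add0n !pair_code1 z1//; move: lt; rewrite ltn_double.
Qed.

Lemma closed_code_pair : closed_code c1 -> closed_code c2 -> closed_code c.
Proof.
move=> [inj1 cl1] [inj2 cl2]; split=> [[x y] [x' y'] E|l lP].
  congr pair; [apply: inj1|apply: inj2]; apply/funext => i.
    by rewrite -(pair_code1 (x, y)) E pair_code1.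
  by rewrite -(pair_code2 (x, y)) E pair_code2.
have [n|x xl] := cl1 (fun i => l i.*2).
  have [z zl] := lP n.*2; exists z.1 => i lt.
  by rewrite -pair_code1 zl// ltn_double.
have [n|y yl] := cl2 (fun i => l i.*2.+1).
  have [z zl] := lP n.*2; exists z.2 => i lt.
  by rewrite -pair_code2 zl// ltn_Sdouble.
exists (x, y); apply/funext => i; rewrite -[i]odd_double_half.
case: (odd i); rewrite ?add1n ?add0n ?pair_code1 ?pair_code2 /=.
  by rewrite yl.
by rewrite xl.
Qed.
End Pair.

Lemma closed_code_sub (Z : choiceType) (c : Z -> nat -> nat) (P : set Z) :
  closed_code c -> stable_under c P ->
  closed_code (fun z : set_type P => c (set_val z)).
Proof.
move=> [inj cl] st; split=> [x y /inj/val_inj//|l lP].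
have [n|z zl] := cl l; first by have [z zl] := lP n; exists (set_val z).
suff Pz : P z by exists (exist _ z (mem_set Pz)).
apply: st => n; have [x xl] := lP n; exists (set_val x); last by rewrite zl.
exact/set_mem/(valP x).
Qed.

(** An open set is the union of the countably many cylinders that it
    contains. *)
Lemma measurable_code_open d (Y : measurableType d) (Z : Type)
    (c : Z -> nat -> nat) (f : Y -> Z) (U : set Z) :
  (forall z, U z -> exists n, forall z', agree n (c z) (c z') -> U z') ->
  (forall i n, measurable [set y | c (f y) i = n]) -> measurable (f @^-1` U).
Proof.
move=> oU mf.
rewrite (_ : f @^-1` U = [set y | exists s : seq nat,
    (forall z, (forall i, (i < size s)%N -> c z i = nth 0%N s i) -> U z) /\
    forall i : nat, (i < size s)%N -> c (f y) i = nth 0%N s i]).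
  apply: measurable_exists => s.
  apply: measurable_and; first exact: measurable_cst_prop.
  by apply: measurable_forall => i; apply: measurable_imply => _; exact: mf.
apply/seteqP; split=> y /=; last by move=> [s [sU]]; exact: sU.
move=> /oU[n nU]; exists (mkseq (c (f y)) n); split=> [z zP|i].
  apply: nU => i lt_in; rewrite zP ?size_mkseq// nth_mkseq//.
by rewrite size_mkseq => lt_in; rewrite nth_mkseq.
Qed.
End Codes.

(** * The space of structures *)
Section GroupCode.

Definition grp_code : grp_struct -> nat -> nat :=
  pair_code (pair_code (fun_code (0%N, 0%N)) (fun_code 0%N)) (fun n _ => n).

Lemma closed_grp_code : closed_code grp_code.
Proof.
apply: closed_code_pair closed_code_nat.
by apply: closed_code_pair; exact: closed_code_fun.
Qed.

(** Otherwise there is a sequence outside of [U] whose [n]-th term agrees with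
    [G] up to [n]; it converges to [G] coordinatewise, hence in the product
    topology. *)
Lemma grp_open (U : set grp_struct) : open U -> forall G, U G ->
  exists n, forall G', agree n (grp_code G) (grp_code G') -> U G'.
Proof.
move=> oU G UG; apply: contrapT => nU.
have /choice[u uP] : forall n,
    exists G', agree n (grp_code G) (grp_code G') /\ ~ U G'.
  move=> n; apply: contrapT => nG; apply: nU; exists n => G' GG'.
  by apply: contrapT => nUG'; apply: nG; exists G'.
have near_eq i : \forall n \near \oo, grp_code (u n) i = grp_code G i.
  by exists i.+1 => // n /= lt; have [->] := uP n.
suff uG : u @ \oo --> G.
  have [n _ /(_ n (leqnn n))] := uG U (open_nbhs_nbhs (conj oU UG)).
  by have [] := uP n.
have ptw (I : countType) (v : nat -> {ptws I -> nat}) (F : {ptws I -> nat}) :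
    (forall i, \forall n \near \oo, v n i = F i) -> v @ \oo --> F.
  move=> vF; apply/cvg_sup => i A [B [[C _ <-]] /= FC sBA].
  by have [N _ NP] := vF i; exists N => // n /= Nn; apply: sBA => /=; rewrite NP.
have add_cvg : (fun n => (u n).1.1) @ \oo --> G.1.1.
  apply: ptw => i; move: (near_eq (pickle i).*2.*2) => [N _ NP].
  by exists N => // n /NP; rewrite /= /grp_code !pair_code1 !fun_codeE.
have opp_cvg : (fun n => (u n).1.2) @ \oo --> G.1.2.
  apply: ptw => i; move: (near_eq (pickle i).*2.+1.*2) => [N _ NP].
  exists N => // n /NP.
  by rewrite /= /grp_code !pair_code1 !pair_code2 !fun_codeE.
have zero_cvg : (fun n => (u n).2) @ \oo --> G.2.
  by apply: cvg_near_cst; move: (near_eq 1%N) => [N _ NP]; exists N => // n /NP.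
have -> : u = (fun n => (((u n).1.1, (u n).1.2), (u n).2)).
  by apply/funext => n; case: (u n) => [[]].
exact: (cvg_pair (cvg_pair add_cvg opp_cvg) zero_cvg).
Qed.

Lemma grp_code_open i n : open [set G : grp_struct | grp_code G i = n].
Proof.
have oG (f : grp_struct -> nat) : continuous f -> open [set G | f G = n].
  move=> fc; apply: (@open_comp _ _ f [set n]) => [x _|]; first exact: fc.
  exact: discrete_open.
have cont1 : continuous (fun G : grp_struct => G.1.1).
  by move=> G; apply: (@cvg_comp _ _ _ fst fst); [exact: cvg_fst|exact: cvg_fst].
have cont2 : continuous (fun G : grp_struct => G.1.2).
  by move=> G; apply: (@cvg_comp _ _ _ fst snd); [exact: cvg_fst|exact: cvg_snd].
have ev (I : countType) p : continuous (fun F : {ptws I -> nat} => F p).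
  exact: proj_continuous.
rewrite -[i]odd_double_half; case: (odd i); rewrite ?add0n ?add1n.
  under eq_set do rewrite /grp_code pair_code2.
  by apply: oG => G; exact: cvg_snd.
under eq_set do rewrite /grp_code pair_code1.
rewrite -[i./2]odd_double_half; case: (odd _); rewrite ?add0n ?add1n.
  under eq_set do rewrite /grp_code pair_code2.
  apply: (oG (fun G => G.1.2 _)) => G A /ev; exact: cont2.
under eq_set do rewrite /grp_code pair_code1.
apply: (oG (fun G => G.1.1 _)) => G A /ev; exact: cont1.
Qed.

Lemma measurable_grp_code i n :
  @measurable _ (borel_of grp_struct) [set G | grp_code G i = n].
Proof. by apply: sub_sigma_algebra; exact: grp_code_open. Qed.
End GroupCode.

(** * The space of torsion-free abelian groups *)
Section NearCode.
Context (Z : Type) (c : Z -> nat -> nat).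

(** [Q] is a neighborhood of [z]. The axioms of the groups are tested on
    finitely many values of the operations, which stay the same near a structure;
    so they hold for limits of groups, by [stable_near]. *)
Definition near_code z (Q : set Z) :=
  exists n, forall z', agree n (c z') (c z) -> Q z'.

Lemma near_code_coord z i : near_code z [set z' | c z' i = c z i].
Proof. by exists i.+1 => z'; apply. Qed.

Lemma near_codeI z (P Q : set Z) :
  near_code z P -> near_code z Q -> near_code z (P `&` Q).
Proof.
move=> [m mP] [n nQ]; exists (maxn m n) => z' zz'; split.
  by apply: mP; apply: agreeW zz'; exact: leq_maxl.
by apply: nQ; apply: agreeW zz'; exact: leq_maxr.
Qed.

Lemma near_codeS z (P Q : set Z) : P `<=` Q -> near_code z P -> near_code z Q.
Proof. by move=> PQ [n nP]; exists n => z' /nP/PQ. Qed.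

Lemma stable_near (P Q : set Z) z :
  (forall n, exists2 z', P z' & agree n (c z') (c z)) ->
  near_code z Q -> exists2 z', P z' & Q z'.
Proof. by move=> zP [n nQ]; have [z' Pz' /nQ] := zP n; exists z'. Qed.
End NearCode.

Section TFABCode.

Lemma near_gadd G x y : near_code grp_code G [set G' | gadd G' x y = gadd G x y].
Proof.
apply: near_codeS (near_code_coord grp_code G (pickle (x, y)).*2.*2) => G' /=.
by rewrite /grp_code !pair_code1 !fun_codeE.
Qed.

Lemma near_gopp G x : near_code grp_code G [set G' | gopp G' x = gopp G x].
Proof.
apply: near_codeS (near_code_coord grp_code G (pickle x).*2.+1.*2) => G' /=.
by rewrite /grp_code !pair_code1 !pair_code2 !fun_codeE.
Qed.

Lemma near_gzero G : near_code grp_code G [set G' | gzero G' = gzero G].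
Proof. exact: near_code_coord grp_code G 1%N. Qed.

Lemma near_gmuln G n x :
  near_code grp_code G [set G' | gmuln G' n x = gmuln G n x].
Proof.
elim: n => [|n IH]; first exact: near_gzero.
apply: near_codeS (near_codeI (near_gadd G x (gmuln G n x)) IH) => G' [/= E IH'].
by rewrite -[LHS]/(gadd G' x (gmuln G' n x)) IH'.
Qed.

Lemma tfab_stable : stable_under grp_code tfab_set.
Proof.
move=> G GP; split.
  split=> [x y z|x y|x|x].
  - have := near_codeI (near_codeI (near_gadd G y z) (near_gadd G x y))
      (near_codeI (near_gadd G x (gadd G y z)) (near_gadd G (gadd G x y) z)).
    move=> /(stable_near GP)[G' [[G'A _ _ _] _] /= [[<- <-]]].
    by rewrite G'A => -[-> <-].
  - have := near_codeI (near_gadd G x y) (near_gadd G y x).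
    by move=> /(stable_near GP)[G' [[_ G'C _ _] _] /= [<- <-]]; rewrite G'C.
  - have := near_codeI (near_gzero G) (near_gadd G (gzero G) x).
    by move=> /(stable_near GP)[G' [[_ _ G'0 _] _] /= [E <-]]; rewrite -E G'0.
  - have := near_codeI (near_codeI (near_gzero G) (near_gopp G x))
      (near_gadd G (gopp G x) x).
    move=> /(stable_near GP)[G' [[_ _ _ G'N] _] /= [[<- E] <-]].
    by rewrite -E G'N.
move=> n x n0 nx0.
have /(stable_near GP)[G' [_ G'tf] /= [E0 E]] :=
  near_codeI (near_gzero G) (near_gmuln G n x).
by rewrite -E0; apply: (G'tf n) => //; rewrite E nx0.
Qed.

Definition tfab_code (G : TFAB) : nat -> nat := grp_code (set_val G).

Lemma closed_tfab_code : closed_code tfab_code.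
Proof. exact: closed_code_sub closed_grp_code tfab_stable. Qed.

(** The product topology has a countable base of cylinders, so that Borel maps
    to it are recognized on the coordinates. *)
Lemma measurable_fun_tfab d (Y : measurableType d) (F : Y -> TFAB_omega) :
  (forall i n, measurable [set y | tfab_code (F y) i = n]) ->
  measurable_fun setT F.
Proof.
move=> mF _ _ [B mB <-]; rewrite setTI setTI.
suff /(_ measurableT B mB) : measurable_fun setT (fun y => tfab_val (F y)).
  by rewrite setTI.
apply: (@measurability _ _ Y (borel_of grp_struct) setT _
  (@open grp_struct) erefl).
move=> _ [U oU <-]; rewrite setTI.
apply: (@measurable_code_open _ _ _ grp_code) => //.
move=> G UG; exact: grp_open.
Qed.

Lemma measurable_tfab_code i n :
  @measurable _ TFAB_omega [set G | tfab_code G i = n].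
Proof.
exists [set G | grp_code G i = n]; first exact: measurable_grp_code.
by rewrite setTI.
Qed.
End TFABCode.

(** * Failures of the Hopf property form an analytic set *)
Section Coanalytic.
Variable R : realType.

Definition tfab_space : Type := baire_sub R closed_tfab_code.
HB.instance Definition _ := Metric.on tfab_space.
HB.instance Definition _ := Pointed.copy tfab_space TFAB.

(** The group, an endomorphism, a section of it, and two elements that it
    identifies. *)
Definition witness : Type :=
  (TFAB * ((nat -> nat) * ((nat -> nat) * (nat * nat))))%type.

Definition witness_code : witness -> nat -> nat :=
  pair_code tfab_code (pair_code (fun_code 0%N) (pair_code (fun_code 0%N)
    (pair_code (fun n _ => n) (fun n _ => n)))).
HB.instance Definition _ := Choice.on witness.

Definition refutes_hopfian : set witness := [set w |
  let: (G, (h, (s, (a, b)))) := w in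
  [/\ endomorphism (tfab_val G) h, forall y, h (s y) = y, a <> b & h a = h b]].

Lemma closed_witness_code : closed_code witness_code.
Proof.
apply: closed_code_pair; first exact: closed_tfab_code.
apply: closed_code_pair; first exact: closed_code_fun.
apply: closed_code_pair; first exact: closed_code_fun.
by apply: closed_code_pair; exact: closed_code_nat.
Qed.

Lemma near_fun_code (F : nat -> nat) x :
  near_code (fun_code 0%N) F [set F' | F' x = F x].
Proof.
apply: near_codeS (near_code_coord (fun_code 0%N) F (pickle x)) => F' /=.
by rewrite !fun_codeE.
Qed.

Lemma near_pair1 (Z1 Z2 : Type) (c1 : Z1 -> nat -> nat)
    (c2 : Z2 -> nat -> nat) z Q :
  near_code c1 z.1 Q -> near_code (pair_code c1 c2) z [set z' | Q z'.1].
Proof. by move=> [n nQ]; exists n.*2 => z' /agree_pair[/nQ]. Qed.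

Lemma near_pair2 (Z1 Z2 : Type) (c1 : Z1 -> nat -> nat)
    (c2 : Z2 -> nat -> nat) z Q :
  near_code c2 z.2 Q -> near_code (pair_code c1 c2) z [set z' | Q z'.2].
Proof. by move=> [n nQ]; exists n.*2 => z' /agree_pair[_ /nQ]. Qed.

Lemma near_wit_gadd (w : witness) x y :
  near_code witness_code w
    [set w' | gadd (tfab_val w'.1) x y = gadd (tfab_val w.1) x y].
Proof.
apply: (@near_pair1 _ _ tfab_code _ w [set G | gadd (tfab_val G) x y = _]).
by have [n nP] := near_gadd (set_val w.1) x y; exists n => G; exact: nP.
Qed.

Lemma near_wit_h (w : witness) x :
  near_code witness_code w [set w' | w'.2.1 x = w.2.1 x].
Proof.
apply: (@near_pair2 _ _ _ _ w [set t | t.1 x = _]).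
by apply: (@near_pair1 _ _ _ _ w.2 [set h | h x = _]); exact: near_fun_code.
Qed.

Lemma near_wit_s (w : witness) x :
  near_code witness_code w [set w' | w'.2.2.1 x = w.2.2.1 x].
Proof.
apply: (@near_pair2 _ _ _ _ w [set t | t.2.1 x = _]).
apply: (@near_pair2 _ _ _ _ w.2 [set t | t.1 x = _]).
by apply: (@near_pair1 _ _ _ _ w.2.2 [set h | h x = _]); exact: near_fun_code.
Qed.

Lemma near_wit_ab (w : witness) :
  near_code witness_code w [set w' | w'.2.2.2 = w.2.2.2].
Proof.
(* The constant codes of a and b sit in the even and in the odd positions of
   the innermost pair: 7 and 15 are their first occurrences. *)
have [n nP] := near_codeI (near_code_coord witness_code w 7)
  (near_code_coord witness_code w 15).
exists n => w' /nP[]; move: w {nP} => [G [h [s [a b]]]].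
move: w' => [G' [h' [s' [a' b']]]].
by rewrite /witness_code /pair_code /= => -> ->.
Qed.

Lemma refutes_stable : stable_under witness_code refutes_hopfian.
Proof.
move=> w wP; case: w wP => [G [h [s [a b]]]]; set w := (G, _) => wP; split.
- move=> x y.
  have := near_codeI
    (near_codeI (near_wit_gadd w x y) (near_wit_gadd w (h x) (h y)))
    (near_codeI (near_wit_h w (gadd (tfab_val G) x y))
                (near_codeI (near_wit_h w x) (near_wit_h w y))).
  move=> /(stable_near wP)[[G' [h' [s' [a' b']]]] [h'D _ _ _] /=].
  move=> [[E1 E2] [E3 [E4 E5]]].
  by rewrite -E3 -E2 -E1 h'D E4 E5.
- move=> y; have := near_codeI (near_wit_s w y) (near_wit_h w (s y)).
  move=> /(stable_near wP)[[G' [h' [s' [a' b']]]] [_ h's' _ _] /= [E1 <-]].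
  by rewrite -E1 h's'.
- have /(stable_near wP) := near_wit_ab w.
  by move=> [[G' [h' [s' [a' b']]]] [_ _ ab _] /= [<- <-]].
- have := near_codeI (near_wit_ab w)
    (near_codeI (near_wit_h w a) (near_wit_h w b)).
  move=> /(stable_near wP)[[G' [h' [s' [a' b']]]] [_ _ _ hab] /=].
  move=> [[Ea Eb] [<- <-]].
  by rewrite -Ea -Eb.
Qed.

Lemma nonhopfianP (G : TFAB) :
  ~ hopfian (tfab_val G) <-> exists t, refutes_hopfian (G, t).
Proof.
split=> [nG|[[h [s [a b]]] [hD hs ab hab]] hopf]; last first.
  by apply: ab; apply: hopf hab => // y; exists (s y).
apply: contrapT => nt; apply: nG => h hD hS a b hab; apply: contrapT => ab.
have /choice[s hs] := hS.
by apply: nt; exists (h, (s, (a, b))).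
Qed.

Lemma analytic_nonhopfian :
  analytic R (~` [set G : TFAB_omega | hopfian (tfab_val G)]).
Proof.
exists tfab_space, (fun G => G); split.
- exact: baire_sub_polish.
- exists (fun G => G); split => //.
    apply: (@measurability _ _ TFAB_omega (borel_of tfab_space) setT _
      (@open _) erefl).
    move=> _ [U oU <-]; rewrite setTI.
    apply: (@measurable_code_open _ _ _ tfab_code); last first.
      exact: measurable_tfab_code.
    move=> G UG; apply/(@baire_sub_nbhs R _ _ closed_tfab_code G U).
    exact: (@open_nbhs_nbhs tfab_space G U (conj oU UG)).
  apply: measurable_fun_tfab => i n; apply: sub_sigma_algebra.
  rewrite openE => G /= Gi; apply/(@baire_sub_nbhs R).
  by exists i.+1 => G' /= GG'; rewrite -GG'.
- rewrite image_id.
  exists (baire_sub R (closed_code_sub closed_witness_code refutes_stable)).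
  exists (fun w => (set_val w).1); split; first exact: baire_sub_polish.
    move=> w A /(@baire_sub_nbhs R)[n nA]; apply/(@baire_sub_nbhs R).
    by exists n.*2 => w' /agree_pair[+ _] => /nA.
  apply/seteqP; split=> [_ [w _ <-]|G /nonhopfianP[t Gt]] /=.
    apply/nonhopfianP; case: w => -[G t] Gt; exists t; exact: (set_mem Gt).
  by exists (exist _ (G, t) (mem_set Gt)).
Qed.
End Coanalytic.

(** * Suslin trees *)
Section Suslin.
Variable R : realType.

Definition scheme_set (W : Type) (K : nat -> nat -> set W) (s : seq nat) : set W :=
  [set w | forall k, (k < size s)%N -> K k (nth 0%N s k) w].

(** With a countable dense set numbered injectively, [K n i] is the ball of
    radius [2 ^ - (n + 1)] around the point of number [i], or is empty when
    there is none. Points chosen in the successive intersections along [b] form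
    a Cauchy sequence, and its limit is the required point. *)
Lemma polish_scheme (W : topologicalType) : polish R W ->
  exists K : nat -> nat -> set W, (forall k w, exists i, K k i w) /\
    forall b : nat -> nat, (forall n, scheme_set K (mkseq b n) !=set0) ->
      exists w : W, forall O, nbhs w O ->
        exists n, scheme_set K (mkseq b n) `<=` O.
Proof.
case=> -[D /countable_injP[f f_inj] D_dense].
move=> [M [h [k [hK kK h_cont k_cont M_complete]]]].
pose r n : R := (2^-1 ^+ n / 2)%R.
pose K n i := [set w | exists d, [/\ D d, f d = i & ball (h d) (r n) (h w)]].
have r0 n : (0 < r n)%R by rewrite divr_gt0// half_expn_gt0.
have Kball n i v w : K n i v -> K n i w -> ball (h v) (2^-1 ^+ n : R)%R (h w).
  move=> [d [Dd fd dv]] [d' [Dd' fd' dw]].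
  have E : d = d' by apply: f_inj; rewrite ?inE// fd fd'.
  by rewrite -E in dw; exact: (ball_splitr dv dw).
exists K; split=> [n w|b bP].
  have [|d [dw Dd]] := D_dense (interior (h @^-1` ball (h w) (r n))) _
    (@open_interior _ _).
    by exists w; apply: h_cont; exact: nbhsx_ballx.
  by exists (f d), d; split => //; apply: ball_sym; exact: (interior_subset dw).
have /choice[u uP] := bP.
have uK p n : (n < p)%N -> K n (b n) (u p).
  by move=> lt; have := uP p n; rewrite size_mkseq nth_mkseq//; exact.
have [|x ux] := M_complete (h \o u).
  apply: cauchy_exP => e /half_expn_small[n ne].
  exists (h (u n.+1)); exists n.+1 => // p /= lt; apply: le_ball (ltW ne) _ _.
  by apply: (Kball _ (b n)); exact: uK.
exists (k x) => O /k_cont/nbhs_ballP[e /= e0 xO].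
have [n ne] := half_expn_small (divr_gt0 e0 (ltr0n R 2)).
exists n.+1 => v vK; rewrite -[v]hK; apply: xO.
have [m _ mP] : \forall p \near \oo, ball x (e / 2)%R (h (u p)).
  by apply: ux; apply: nbhsx_ballx; rewrite divr_gt0.
apply: (ball_split (mP (maxn m n.+1) (leq_maxl _ _))).
apply: le_ball (ltW ne) _ _; apply: (Kball _ (b n)); first exact/uK/leq_maxr.
by have := vK n; rewrite size_mkseq nth_mkseq//; exact.
Qed.

Lemma polish_hausdorff (X : topologicalType) : polish R X -> hausdorff_space X.
Proof.
case=> _ [M [h [k [hK kK h_cont k_cont _]]]] p q pq.
rewrite -[p]hK -[q]hK; congr k; apply: metric_hausdorff => A B pA qB.
have [x [Ax Bx]] := pq _ _ (h_cont p _ pA) (h_cont q _ qB).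
by exists (h x).
Qed.

Lemma closed_measurable (X : ptopologicalType) (C : set X) :
  closed C -> @measurable _ (borel_of X) C.
Proof.
move=> cC; rewrite -[C]setCK; apply: measurableC; apply: sub_sigma_algebra.
exact: closed_openC.
Qed.

Section Tree.
Variables (W : topologicalType) (X : ptopologicalType) (g : W -> X).
Variable K : nat -> nat -> set W.

(** The closure makes the condition at [s] Borel in [x]; it does no harm along
    a branch, where the sets shrink to a point. The root is always included so
    that the group of the tree is infinite. *)
Definition suslin_tree (x : X) : set (seq nat) :=
  [set s | s = [::] \/ closure (g @` scheme_set K s) x].

Lemma suslin_tree_prefix x s t : prefix s t -> suslin_tree x t -> suslin_tree x s.
Proof.
move=> st [t0|tx]; first by move: st; rewrite t0 prefixs0 => /eqP; left.
right; apply: closureS tx; apply: image_subset => w wt k lt_ks.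
move/prefixP: st wt => [u ->] /(_ k); rewrite nth_cat lt_ks size_cat; apply.
exact: ltn_addr.
Qed.

Lemma suslin_tree_measurable s :
  @measurable _ (borel_of X) [set x | suslin_tree x s].
Proof.
apply: (@measurableU _ (borel_of X) [set _ | s = [::]] (closure _)).
  exact: measurable_cst_prop.
by apply: closed_measurable; exact: closed_closure.
Qed.

Hypotheses (X_hausdorff : hausdorff_space X) (g_cont : continuous g).
Hypothesis K_cover : forall k w, exists i, K k i w.
Hypothesis K_shrink : forall b : nat -> nat,
  (forall n, scheme_set K (mkseq b n) !=set0) ->
  exists w : W, forall O, nbhs w O -> exists n, scheme_set K (mkseq b n) `<=` O.

(** Along a branch the scheme shrinks to some [w]. Every neighborhood of [g w]
    contains the image of a set of the scheme, to the closure of which [x]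
    belongs; so [x] and [g w] have no disjoint neighborhoods. *)
Lemma suslin_treeP x : infinite_branch (suslin_tree x) <-> range g x.
Proof.
split=> [[b bP]|[w _ <-]]; last first.
  have /choice[b bP] : forall k, exists i, K k i w by move=> k; exact: K_cover.
  exists b => n; right; apply: subset_closure; exists w => // k.
  by rewrite size_mkseq => lt; rewrite nth_mkseq.
have {}bP n : closure (g @` scheme_set K (mkseq b n)) x.
  case: (bP n.+1) => [/(congr1 size)|]; first by rewrite size_mkseq.
  apply: closureS; apply: image_subset => w wn k; rewrite size_mkseq => lt.
  have := wn k; rewrite size_mkseq !nth_mkseq ?(leqW lt)//; exact.
have [n|w wP] := K_shrink (b := b).
  by have [_ [[w wn _] _]] := bP n _ filterT; exists w.
exists w => //; apply: X_hausdorff => A C wA xC.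
have [n nA] := wP _ (g_cont wA).
by have [_ [[v vn <-] Cv]] := bP n _ xC; exists (g v); split => //; exact: nA.
Qed.
End Tree.
End Suslin.

(** * Completeness *)
Section DoubledTree.
Local Open Scope ring_scope.

(** Two nodes lie over each successor of a node of [S], which are the two
    successors needed by [branch_shift_surj]. *)
Definition doubled (S : set (seq nat)) : set (seq nat) :=
  [set w | S (map half w)].

(** Witnesses that the group of a tree is infinite. *)
Definition root_multiple (i : nat) : {poly rat} := monom [::] i%:R.

Lemma root_multiple_inj : injective root_multiple.
Proof.
move=> i j /(congr1 (fun f => coord f [::])); rewrite !coord_monom eqxx.
by move/eqP; rewrite eqr_nat => /eqP.
Qed.

Lemma root_multiple_group (S : set (seq nat)) i :
  S [::] -> tree_group (doubled S) (root_multiple i).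
Proof.
move=> S0; apply: tree_group_monom => //.
by apply: semilocal_int; rewrite rpred_nat.
Qed.

Lemma tree_struct_tfab (S : set (seq nat)) : S [::] ->
  tfab_set (subgroup_struct (tree_group (doubled S))).
Proof.
move=> S0; apply: (@subgroup_struct_tfab _ root_multiple).
- exact: root_multiple_inj.
- by move=> i; exact: root_multiple_group.
- exact: tree_group0.
- exact: tree_groupN.
- exact: tree_groupD.
Qed.

(** Halving the entries of an infinite branch of [doubled S] gives one of [S];
    conversely, the shift is defined directly from a branch of [S]. *)
Lemma tree_struct_hopfianP (S : set (seq nat)) : S [::] ->
  (forall u w, prefix u w -> S w -> S u) ->
  hopfian (subgroup_struct (tree_group (doubled S))) <-> ~ infinite_branch S.
Proof.
move=> S0 S_prefix.
have Hs i : tree_group (doubled S) (root_multiple i) by exact: root_multiple_group.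
split=> [+ [b Sb]|nS].
  have [Gf hf0 f0] := branch_shift_not_inj Sb.
  apply: (nonhopfian_subgroup root_multiple_inj Hs _ _ _ _ _ Gf hf0 f0).
  - exact: tree_group0.
  - exact: tree_groupD.
  - by move=> f; exact: branch_shift_group.
  - by move=> f g _ _; exact: branch_shiftD.
  - exact: branch_shift_surj.
apply: (hopfian_subgroup root_multiple_inj Hs).
- exact: tree_groupN.
- exact: tree_groupD.
- move=> h; apply: wf_tree_group_hopfian => [u w uw|[b Tb]].
    apply: S_prefix; move/prefixP: uw => [t ->].
    by rewrite map_cat; exact: prefix_prefix.
  apply: nS; exists (fun k => (b k)./2) => n.
  by have := Tb n; rewrite /doubled /= /mkseq -map_comp.
Qed.
End DoubledTree.

Theorem theorem1p5 (R : realType) :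
  complete_coanalytic R [set G : TFAB_omega | hopfian (tfab_val G)].
Proof.
split; first exact: analytic_nonhopfian.
move=> d Y B _ [X [f [X_polish [f' [fK _ f_meas _]]]]].
move=> [W [g [W_polish g_cont g_range]]].
have [K [K_cover K_shrink]] := polish_scheme W_polish.
pose S y := suslin_tree g K (f y).
have S0 y : S y [::] by left.
pose F y : TFAB_omega :=
  exist (fun G => G \in tfab_set) _ (mem_set (tree_struct_tfab (S0 y))).
exists F; split.
  apply: measurable_fun_tfab => i n.
  have mS w : measurable [set y | S y w].
    have := f_meas measurableT _ (suslin_tree_measurable g K w).
    by rewrite setTI.
  have mT f0 : measurable [set y | tree_group (doubled (S y)) f0].
    by apply: measurable_tree_group => w; exact: mS.
  have [m1 m2 m3] := measurable_subgroup_struct mT (fun=> root_multiple_inj)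
    (fun y i => @root_multiple_group _ i (S0 y)).
  rewrite /tfab_code /grp_code /pair_code /=.
  case: (odd i); first exact: m3.
  by case: (odd i./2); [exact: m2|exact: m1].
have FP y : hopfian (tfab_val (F y)) <-> B y.
  have prefixS : forall u w, prefix u w -> S y w -> S y u.
    by move=> u w; exact: suslin_tree_prefix.
  have branchP := suslin_treeP (polish_hausdorff X_polish) g_cont
    K_cover K_shrink (f y).
  have rangeP : range g (f y) <-> ~ B y.
    rewrite g_range; split=> [[z nBz fzy]|nBy]; last by exists y.
    by rewrite -(can_inj fK fzy).
  apply: (iff_trans (tree_struct_hopfianP (S0 y) prefixS)).
  split=> [nb|By /branchP/rangeP//].
  by apply: contrapT => /rangeP/branchP.
by apply/seteqP; split=> y /FP.
Qed.
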